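(* Let $\Omega\subset\mathbb{X}$ be a convex compact set and $\kappa$ a positive integer such that $\Omega\cap\mathcal{R}\neq\emptyset$, where $\mathcal{R}=\{X\in\mathbb{X} : \mathrm{rank}(X)\le\kappa\}$, and let $\Gamma:\mathbb{R}\rightrightarrows\mathbb{X}$ be the multifunction $\Gamma(\omega)=\{X\in\Omega : \sum_{i=\kappa+1}^n\sigma_i(X)=\omega\}$. Then $\Gamma$ is calm at $0$ for each $X\in\Gamma(0)$ if and only if there exists a constant $c>0$ such that $$\mathrm{dist}(Z,\Gamma(0))\le c\,\mathrm{dist}(0,\Gamma^{-1}(Z))=c\sum_{i=\kappa+1}^n\sigma_i(Z)\quad\text{for all } Z\in\Omega.$$
   Context: $\mathbb{X}$ denotes either $\mathbb{R}^{n_1\times n_2}$ (with $n=\min(n_1,n_2)$) or the space $\mathbb{H}^n$ of $n\times n$ Hermitian matrices, endowed with the trace inner product and its induced Frobenius norm $\|\cdot\|_F$; $\mathrm{dist}$ is the distance in $\|\cdot\|_F$ (on $\mathbb{R}$, the absolute value). $\sigma_1(X)\ge\cdots\ge\sigma_n(X)\ge 0$ are the singular values of $X$, and an empty sum is $0$. Note that $\Gamma(0)=\Omega\cap\mathcal{R}$. $\Gamma^{-1}(Z)=\{\omega\in\mathbb{R}: Z\in\Gamma(\omega)\}$. Calmness: a multifunction $\Upsilon:\mathbb{Y}\rightrightarrows\mathbb{Z}$ between finite dimensional normed spaces is calm at $\overline{y}$ for $\overline{z}\in\Upsilon(\overline{y})$ if there exist a constant $\alpha\ge0$ and neighborhoods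 $\mathcal{U}$ of $\overline{y}$ and $\mathcal{V}$ of $\overline{z}$ such that $\Upsilon(y)\cap\mathcal{V}\subseteq\Upsilon(\overline{y})+\alpha\|y-\overline{y}\|\mathbb{B}_{\mathbb{Z}}$ for all $y\in\mathcal{U}$, where $\mathbb{B}_{\mathbb{Z}}$ is the closed unit ball of $\mathbb{Z}$ centered at the origin. *)

(* Defs.v *)
From HB Require Import structures.
From mathcomp Require Import all_boot all_order all_algebra.
From mathcomp Require Import sesquilinear spectral complex.
From mathcomp Require Import all_classical all_reals all_analysis.

Set Implicit Arguments.
Unset Strict Implicit.
Unset Printing Implicit Defensive.

Import Order.TTheory GRing.Theory Num.Theory numFieldNormedType.Exports.

Local Open Scope classical_set_scope.
Local Open Scope ring_scope.
Local Open Scope sesquilinear_scope.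
Local Open Scope complex_scope.

Section InnerProductNorm.
Context {R : realType} {V : lmodType R} (f : V -> V -> R).
Hypothesis fC : forall u v, f u v = f v u.
Hypothesis fP : forall a u v w, f (a *: u + v) w = a * f u w + f v w.
Hypothesis f_ge0 : forall u, 0 <= f u u.
Hypothesis f_eq0 : forall u, f u u = 0 -> u = 0.

Let fD u v w : f (u + v) w = f u w + f v w.
Proof. by rewrite -[u]scale1r fP mul1r scale1r. Qed.

Let f0 w : f 0 w = 0.
Proof. by have /eqP := fD 0 0 w; rewrite addr0 -subr_eq0 opprD addNKr oppr_eq0 => /eqP. Qed.

Let fZ a u w : f (a *: u) w = a * f u w.
Proof. by rewrite -[a *: u]addr0 fP f0 addr0. Qed.

Lemma cauchy_schwarz u v : f u v ^+ 2 <= f u u * f v v.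
Proof.
have [v0|vn0] := eqVneq (f v v) 0.
  by rewrite (f_eq0 v0) fC f0 expr0n /= f0 mulr0.
have v_gt0 : 0 < f v v by rewrite lt_neqAle eq_sym vn0 f_ge0.
have := f_ge0 (f v v *: u + (- f u v) *: v).
rewrite fP fZ ![f _ (_ + _)]fC !fP !fZ (fC v u).
have -> : f v v * (f v v * f u u + - f u v * f u v) +
          - f u v * (f v v * f u v + - f u v * f v v)
        = f v v * (f u u * f v v - f u v ^+ 2).
  rewrite expr2 !mulNr [f u v * f v v]mulrC subrr mulr0 oppr0 addr0.
  by rewrite [f u u * _]mulrC.
by rewrite pmulr_rge0// subr_ge0.
Qed.

Lemma inner_normD u v :
  Num.sqrt (f (u + v) (u + v)) <= Num.sqrt (f u u) + Num.sqrt (f v v).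
Proof.
rewrite -[leRHS]ger0_norm ?addr_ge0 ?sqrtr_ge0// -sqrtr_sqr.
rewrite ler_wsqrtr// sqrrD !sqr_sqrtr// fD ![f _ (_ + _)]fC !fD (fC v u).
rewrite addrA lerD2r -addrA lerD2l -mulr2n lerMn2r/= -sqrtrM//.
apply: (le_trans (ler_norm _)); rewrite -sqrtr_sqr ler_wsqrtr//.
exact: cauchy_schwarz.
Qed.

Lemma inner_normZ a u :
  Num.sqrt (f (a *: u) (a *: u)) = `|a| * Num.sqrt (f u u).
Proof. by rewrite fZ fC fZ mulrA -expr2 sqrtrM ?sqr_ge0// sqrtr_sqr. Qed.

Lemma inner_normr0_eq0 u : Num.sqrt (f u u) = 0 -> u = 0.
Proof.
move=> /eqP; rewrite sqrtr_eq0 => u0; apply: f_eq0.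
by apply/eqP; rewrite eq_le u0 f_ge0.
Qed.
End InnerProductNorm.

(* The alias keeps the Frobenius norm apart from the max-entry norm that the
   library puts on 'M[R]_(m, n). *)
Definition rect_mx (R : realType) (m n : nat) : Type := 'M[R]_(m, n).

HB.instance Definition _ (R : realType) m n :=
  GRing.Lmodule.copy (rect_mx R m n) 'M[R]_(m, n).

Section RealMatrices.
Context {R : realType} {m n : nat}.
Implicit Types A B : rect_mx R m n.

Definition rect_mx_dot A B : R := \tr ((A : 'M[R]_(m, n))^T *m B).

Let dotC A B : rect_mx_dot A B = rect_mx_dot B A.
Proof. by rewrite /rect_mx_dot -mxtrace_tr trmx_mul trmxK. Qed.

Let dotP a A B D :
  rect_mx_dot (a *: A + B) D = a * rect_mx_dot A D + rect_mx_dot B D.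
Proof.
by rewrite /rect_mx_dot linearP/= mulmxDl -scalemxAl mxtraceD mxtraceZ.
Qed.

Let dotE A : rect_mx_dot A A = \sum_j \sum_i (A : 'M[R]_(m, n)) i j ^+ 2.
Proof.
apply: eq_bigr => j _; rewrite mxE; apply: eq_bigr => i _.
by rewrite mxE expr2.
Qed.

Let dot_ge0 A : 0 <= rect_mx_dot A A.
Proof. by rewrite dotE !sumr_ge0// => j _; rewrite sumr_ge0// => i _; rewrite sqr_ge0. Qed.

Let dot_eq0 A : rect_mx_dot A A = 0 -> A = 0.
Proof.
rewrite dotE => /eqP; rewrite psumr_eq0; last first.
  by move=> j _; rewrite sumr_ge0// => i _; rewrite sqr_ge0.
move=> /allP A0; apply/matrixP => i j; rewrite mxE.
have := A0 j (mem_index_enum _); rewrite psumr_eq0; last first.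
  by move=> i' _; rewrite sqr_ge0.
by move=> /allP/(_ i (mem_index_enum _)) /=; rewrite sqrf_eq0 => /eqP.
Qed.

HB.instance Definition _ := @Lmodule_isNormed.Build R (rect_mx R m n)
  (fun A => Num.sqrt (rect_mx_dot A A))
  (inner_normD dotC dotP dot_ge0 dot_eq0)
  (inner_normZ dotC dotP)
  (inner_normr0_eq0 dot_ge0 dot_eq0).
End RealMatrices.

Definition is_herm (R : realType) (n : nat) : {pred 'M[R[i]]_n} :=
  fun M => M \is hermsymmx.

Record herm_mx (R : realType) (n : nat) : Type := HermMx {
  herm_val :> 'M[R[i]]_n ;
  herm_valP : herm_val \in @is_herm R n }.

HB.instance Definition _ (R : realType) n := [isSub for @herm_val R n].
HB.instance Definition _ (R : realType) n := [Choice of herm_mx R n by <:].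

Section HermitianMatrices.
Context {R : realType} {n : nat}.
Implicit Types A B : herm_mx R n.

Let hermE (M : 'M[R[i]]_n) : (M \in @is_herm R n) = (M == M ^t*).
Proof. by rewrite -topredE/= /is_herm is_hermitianmxE expr0 scale1r. Qed.

Let hermK A : herm_val A ^t* = herm_val A.
Proof. by apply/esym/eqP; rewrite -hermE herm_valP. Qed.

Fact herm_zmod_closed : zmod_closed (@is_herm R n).
Proof.
split=> [|M N]; rewrite !hermE; first by rewrite trmx0 map_mx0.
by move=> /eqP EM /eqP EN; rewrite linearB/= map_mxB -EM -EN.
Qed.

HB.instance Definition _ :=
  GRing.isZmodClosed.Build 'M[R[i]]_n (@is_herm R n) herm_zmod_closed.
HB.instance Definition _ :=
  [SubChoice_isSubZmodule of herm_mx R n by <:].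

Fact herm_scale_closed (a : R) A : a%:C *: herm_val A \in @is_herm R n.
Proof.
rewrite hermE linearZ/= map_mxZ hermK.
by rewrite -[X in _ == X *: _]/((a%:C)^*)%C conjc_real.
Qed.

Definition herm_scale (a : R) A : herm_mx R n := HermMx (herm_scale_closed a A).

Let scaleA a b A : herm_scale a (herm_scale b A) = herm_scale (a * b) A.
Proof. by apply/val_inj; rewrite /= scalerA rmorphM. Qed.
Let scale1 : left_id 1 herm_scale.
Proof. by move=> A; apply/val_inj; rewrite /= scale1r. Qed.
Let scaleDr : right_distributive herm_scale +%R.
Proof. by move=> a A B; apply/val_inj; rewrite /= scalerDr. Qed.
Let scaleDl A : {morph herm_scale^~ A : a b / a + b}.
Proof. by move=> a b; apply/val_inj; rewrite /= rmorphD scalerDl. Qed.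

HB.instance Definition _ := GRing.Zmodule_isLmodule.Build R (herm_mx R n)
  scaleA scale1 scaleDr scaleDl.

(* The trace of A^* B is real when A and B are Hermitian. *)
Definition herm_dot A B : R := complex.Re (\tr ((herm_val A) ^t* *m herm_val B)).

Let dotC A B : herm_dot A B = herm_dot B A.
Proof. by rewrite /herm_dot !hermK mxtrace_mulC. Qed.

Let dotP a A B D : herm_dot (a *: A + B) D = a * herm_dot A D + herm_dot B D.
Proof.
rewrite /herm_dot !hermK/= mulmxDl -scalemxAl mxtraceD mxtraceZ.
by rewrite raddfD/=; case: (\tr _) => x y /=; rewrite mul0r subr0.
Qed.

Let dotE A : (herm_dot A A)%:C = \sum_j \sum_i `|herm_val A i j| ^+ 2.
Proof.
rewrite /herm_dot; have -> : \tr ((herm_val A) ^t* *m herm_val A) =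
    \sum_j \sum_i `|herm_val A i j| ^+ 2.
  apply: eq_bigr => j _; rewrite mxE; apply: eq_bigr => i _.
  by rewrite !mxE normCKC.
rewrite RRe_real// ger0_real// sumr_ge0// => j _.
by rewrite sumr_ge0// => i _; rewrite exprn_ge0.
Qed.

Let dot_ge0 A : 0 <= herm_dot A A.
Proof.
rewrite -lecR dotE sumr_ge0// => j _.
by rewrite sumr_ge0// => i _; rewrite exprn_ge0.
Qed.

Let dot_eq0 A : herm_dot A A = 0 -> A = 0.
Proof.
move=> A0; have /eqP := dotE A; rewrite A0 eq_sym psumr_eq0; last first.
  by move=> j _; rewrite sumr_ge0// => i _; rewrite exprn_ge0.
move=> /allP {}A0; apply/val_inj/matrixP => i j; rewrite mxE.
have := A0 j (mem_index_enum _); rewrite psumr_eq0; last first.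
  by move=> i' _; rewrite exprn_ge0.
move=> /allP/(_ i (mem_index_enum _)) /=.
by rewrite sqrf_eq0 normr_eq0 => /eqP.
Qed.

HB.instance Definition _ := @Lmodule_isNormed.Build R (herm_mx R n)
  (fun A => Num.sqrt (herm_dot A A))
  (inner_normD dotC dotP dot_ge0 dot_eq0)
  (inner_normZ dotC dotP)
  (inner_normr0_eq0 dot_ge0 dot_eq0).
End HermitianMatrices.

(* All singular values with multiplicity, in nonincreasing order, obtained as
   the square roots of the eigenvalues of A^* A. The sequence has n entries; for
   m < n the entries beyond position m vanish, and they are never summed
   below. *)
Definition singular_values (R : realType) (m n : nat) (A : 'M[R[i]]_(m, n)) :
    seq R :=
  sort >=%R [seq Num.sqrt (complex.Re (spectral_diag (A ^t* *m A) 0 j))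
            | j <- enum 'I_n].

Inductive space_kind : Type :=
  | RealRectangular of nat & nat
  | ComplexHermitian of nat.

Definition matrix_space (R : realType) (k : space_kind) : normedModType R :=
  match k with
  | RealRectangular n1 n2 => rect_mx R n1 n2
  | ComplexHermitian n => herm_mx R n
  end.

Definition min_dim (k : space_kind) : nat :=
  match k with
  | RealRectangular n1 n2 => minn n1 n2
  | ComplexHermitian n => n
  end.

Definition mx_rank (R : realType) (k : space_kind) : matrix_space R k -> nat :=
  match k with
  | RealRectangular n1 n2 => fun X : rect_mx R n1 n2 => \rank (X : 'M[R]_(n1, n2))
  | ComplexHermitian n => fun X : herm_mx R n => \rank (herm_val X)
  end.

(* Indexed from 1, as in sigma_1 >= ... >= sigma_n. *)
Definition sigma (R : realType) (k : space_kind) (i : nat) : matrix_space R k -> R :=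
  match k with
  | RealRectangular n1 n2 => fun X : rect_mx R n1 n2 =>
      nth 0 (singular_values (map_mx (real_complex R) (X : 'M[R]_(n1, n2)))) i.-1
  | ComplexHermitian n => fun X : herm_mx R n =>
      nth 0 (singular_values (herm_val X)) i.-1
  end.

Definition tail_sum (R : realType) (k : space_kind) (kappa : nat)
    (X : matrix_space R k) : R :=
  \sum_(kappa.+1 <= i < (min_dim k).+1) sigma i X.

Definition rank_le (R : realType) (k : space_kind) (kappa : nat) :
    set (matrix_space R k) :=
  [set X | (mx_rank X <= kappa)%N].

Definition Gamma (R : realType) (k : space_kind) (Omega : set (matrix_space R k))
    (kappa : nat) (omega : R^o) : set (matrix_space R k) :=
  [set X | Omega X /\ tail_sum kappa X = omega].

Definition multi_inv (Y Z : Type) (Upsilon : Y -> set Z) (z : Z) : set Y :=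
  [set y | Upsilon y z].

Definition calm (R : realType) (Y Z : normedModType R) (Upsilon : Y -> set Z)
    (ybar : Y) (zbar : Z) : Prop :=
  exists2 alpha : R, 0 <= alpha &
  exists U V, [/\ nbhs ybar U, nbhs zbar V &
    forall y, U y ->
      Upsilon y `&` V `<=`
      [set z + (alpha * `|y - ybar|) *: b |
        z in Upsilon ybar & b in [set b : Z | `|b| <= 1]]].

(* Main.v *)
Require Import Defs.
From mathcomp Require Import all_boot all_order all_algebra.
From mathcomp Require Import sesquilinear spectral complex.
From mathcomp Require Import all_classical all_reals all_analysis.
Import Order.TTheory GRing.Theory Num.Theory.
Import numFieldNormedType.Exports.

Set Implicit Arguments.
Unset Strict Implicit.
Unset Printing Implicit Defensive.

Local Open Scope classical_set_scope.
Local Open Scope ring_scope.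

(* Write t(Z) for the tail sum and G for Gamma(0). The inverse Gamma^-1(Z) is
   {t(Z)}, so calmness at a point of G is the bound dist(Z, G) <= alpha t(Z) for
   Z in Omega near that point with t(Z) small. Since dist(., G) is bounded on
   Omega, such a bound also holds, with another constant, wherever t is bounded
   below by a positive constant. This is the case near every point of Omega
   outside G: if t(X) > 0 then rank X > kappa, while truncating the singular
   value decomposition of Z gives a matrix of rank at most kappa at distance
   O(sigma_(kappa+1)(Z)) from Z, so that sigma_(kappa+1) stays away from 0 near X
   because the rank is lower semicontinuous. Compactness of Omega makes the
   constants uniform. Conversely, the global bound gives calmness with constant
   2c; the factor 2 replaces the attainment of the distance to G. *)

(** * Entrywise norm and lower semicontinuity of the rank *)

Section EntrywiseL1Norm.
Context {K : numFieldType}.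

(** This norm takes its values in [K] itself and is submultiplicative, which is what the
    perturbation argument for the rank uses. *)
Definition mx_l1norm m n (A : 'M[K]_(m, n)) : K := \sum_i \sum_j `|A i j|.

Lemma mx_l1norm_ge0 m n (A : 'M[K]_(m, n)) : 0 <= mx_l1norm A.
Proof. by apply: sumr_ge0 => i _; apply: sumr_ge0. Qed.

Lemma mx_l1norm_eq0 m n (A : 'M[K]_(m, n)) : mx_l1norm A = 0 -> A = 0.
Proof.
move=> /eqP; rewrite psumr_eq0; last by move=> i _; apply: sumr_ge0.
move=> /allP A0; apply/matrixP => i j; rewrite mxE.
have := A0 i (mem_index_enum _); rewrite psumr_eq0//.
by move=> /allP/(_ j (mem_index_enum _)); rewrite normr_eq0 => /eqP.
Qed.

Lemma mx_l1normD m n (A B : 'M[K]_(m, n)) :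
  mx_l1norm (A + B) <= mx_l1norm A + mx_l1norm B.
Proof.
rewrite -big_split ler_sum// => i _; rewrite -big_split ler_sum// => j _.
by rewrite mxE ler_normD.
Qed.

Lemma mx_l1normM m n p (A : 'M[K]_(m, n)) (B : 'M[K]_(n, p)) :
  mx_l1norm (A *m B) <= mx_l1norm A * mx_l1norm B.
Proof.
rewrite [leRHS]mulr_suml ler_sum// => i _.
apply: (@le_trans _ _ (\sum_j \sum_k `|A i k| * `|B k j|)).
  apply: ler_sum => j _; rewrite mxE (le_trans (ler_norm_sum _ _ _))//.
  by apply: ler_sum => k _; rewrite normrM.
rewrite exchange_big mulr_suml ler_sum//= => k _.
rewrite -mulr_sumr ler_wpM2l// /mx_l1norm [leRHS](bigD1 k)//= lerDl.
by apply: sumr_ge0 => l _; apply: sumr_ge0.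
Qed.

(** A full-rank factorization of [A] gives [L] and [Q] with [L *m A *m Q] the identity of size
    [\rank A]. For [B] close to [A], [L *m B *m Q] stays invertible, which forces [B] to have at
    least that rank. *)
Lemma mxrank_lower_semicontinuous m n (A : 'M[K]_(m, n)) :
  exists2 e : K, 0 < e &
    forall B, mx_l1norm (A - B) < e -> (\rank A <= \rank B)%N.
Proof.
pose L := pinvmx (col_base A); pose Q := pinvmx (row_base A).
have LAQ : L *m A *m Q = 1%:M.
  have -> : L *m A = row_base A.
    by rewrite -[RHS]mul1mx -(mulVpmx (col_base_full A)) -mulmxA mulmx_base.
  by rewrite mulmxVp ?row_base_free.
have cge0 : 0 <= mx_l1norm L * mx_l1norm Q by rewrite mulr_ge0 ?mx_l1norm_ge0.
(* The summand 1 keeps the inverse positive when [A] is zero and [L], [Q] are empty. *)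
exists (1 + mx_l1norm L * mx_l1norm Q)^-1; first by rewrite invr_gt0 ltr_pwDl.
move=> B ABe.
have E1 : mx_l1norm (L *m (A - B) *m Q) < 1.
  apply: (le_lt_trans (mx_l1normM _ _)).
  apply: (@le_lt_trans _ _ (mx_l1norm L * mx_l1norm (A - B) * mx_l1norm Q)).
    by rewrite ler_wpM2r ?mx_l1norm_ge0// mx_l1normM.
  rewrite mulrAC.
  apply: (@le_lt_trans _ _
      ((1 + mx_l1norm L * mx_l1norm Q) * mx_l1norm (A - B))).
    by rewrite ler_wpM2r ?mx_l1norm_ge0// lerDr.
  by rewrite -ltr_pdivlMl ?mulr1// ltr_pwDl.
suff /eqP <- : row_free (L *m B *m Q).
  by rewrite (leq_trans (mxrankM_maxl _ _))// mxrankM_maxr.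
(* L A Q is the identity, so a vector killed by L B Q is fixed by
   L (A - B) Q, which has norm < 1. *)
apply: inj_row_free => v vLBQ; apply: mx_l1norm_eq0; apply/eqP.
have vE : v = v *m (L *m (A - B) *m Q).
  by rewrite mulmxBr mulmxBl LAQ mulmxBr mulmx1 vLBQ subr0.
apply: contraT => v0; have vgt0 : 0 < mx_l1norm v by rewrite lt0r v0 mx_l1norm_ge0.
have := mx_l1normM v (L *m (A - B) *m Q); rewrite -vE => /le_lt_trans.
by move=> /(_ (mx_l1norm v)); rewrite gtr_pMr// ltxx => /(_ E1).
Qed.

End EntrywiseL1Norm.

(** * Rank of diagonal matrices *)

Lemma mxrank_sum_leq (F : fieldType) (I : finType) (P : pred I) m n
    (A : I -> 'M[F]_(m, n)) :
  (\rank (\sum_(i | P i) A i)%R <= \sum_(i | P i) \rank (A i))%N.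
Proof.
elim/big_rec2: _ => [|i k M _ Mk]; first by rewrite mxrank0.
by rewrite (leq_trans (mxrank_add _ _))// leq_add2l.
Qed.

Lemma mxrank_diag_leq (F : fieldType) n (d : 'rV[F]_n) :
  (\rank (diag_mx d) <= #|[pred j | d 0%R j != 0%R]|)%N.
Proof.
have -> : diag_mx d = \sum_(j | d 0 j != 0) d 0 j *: delta_mx j j.
  rewrite [RHS]big_mkcond/=; apply/matrixP => i j.
  rewrite summxE (bigD1 i)//= big1 ?addr0 => [|k ki].
    case: (eqVneq (d 0 i) 0) => [di|_]; rewrite !mxE ?di ?mul0rn//=.
    by rewrite eqxx [j == i]eq_sym mulr_natr.
  by case: ifP => _; rewrite !mxE// eq_sym (negPf ki) mulr0.
rewrite (leq_trans (mxrank_sum_leq _ _))// -sum1_card leq_sum// => j _.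
by rewrite (leq_trans (mxrank_scale _ _))// mxrank_delta.
Qed.

Lemma mxrank_diag (F : fieldType) n (d : 'rV[F]_n) :
  \rank (diag_mx d) = #|[pred j | d 0%R j != 0%R]|.
Proof.
apply/eqP; rewrite eqn_leq mxrank_diag_leq/=.
(* Filling the zero entries of [d] with ones gives an invertible matrix, so subadditivity of the
   rank bounds [\rank (diag_mx d)] from below. *)
pose e : 'rV[F]_n := \row_j (d 0 j == 0)%:R.
have eE : #|[pred j | e 0 j != 0]| = #|[predC [pred j | d 0 j != 0]]|.
  by apply: eq_card => j; rewrite !inE mxE; case: (d 0 j == 0); rewrite ?oner_eq0 ?eqxx.
have : (n <= \rank (diag_mx d) + #|[predC [pred j | d 0%R j != 0%R]]|)%N.
  rewrite -eE; apply: leq_trans (leq_add (leqnn _) (mxrank_diag_leq e)).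
  apply: leq_trans (mxrank_add _ _).
  have : row_free (diag_mx d + diag_mx e).
    rewrite -linearD/= row_free_unit unitmxE det_diag unitfE; apply/prodf_neq0 => j _.
    by rewrite !mxE; case: (eqVneq (d 0 j) 0) => [->|]; rewrite ?add0r ?oner_neq0// addr0.
  by move=> /eqP ->.
by rewrite -{1}(card_ord n) -(cardC [pred j | d 0 j != 0]) leq_add2r.
Qed.

(** * Counting in nonincreasing sequences *)

Section NonincreasingSort.
Context {R : realDomainType}.
Implicit Types s : seq R.

(** From position [k] on, no sorted entry exceeds the one at [k]; strictly larger entries sit in the
    first [k] places, whatever the ties. *)
Lemma sort_ge_count s k :
  (count (> (nth 0%R (sort >=%R s) k)) s <= k)%N.
Proof.
set x := nth _ _ _; rewrite -(count_sort >=%R) -(cat_take_drop k (sort >=%R s)).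
rewrite count_cat -[leqRHS]addn0 leq_add//.
  by rewrite (leq_trans (count_size _ _))// size_take_min geq_minl.
rewrite leqn0 eqn0Ngt -has_count -all_predC; apply/(all_nthP 0) => i.
rewrite size_drop ltn_subRL => ki /=; rewrite nth_drop -leNgt /x.
have sorted_s : sorted >=%R (sort >=%R s) by apply: sort_sorted; exact: ge_total.
by apply: (sorted_leq_nth ge_trans ge_refl 0 sorted_s) => //; rewrite ?inE ?leq_addr//
  (leq_ltn_trans _ ki)// leq_addr.
Qed.

(** A positive entry at position [k] would make the first [k.+1] sorted entries positive. *)
Lemma sort_ge_eq0 s k : all (>= 0) s -> (count (> 0%R) s <= k)%N ->
  nth 0 (sort >=%R s) k = 0.
Proof.
move=> s0 sk; have [ks|sk'] := ltnP k (size s); last first.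
  by rewrite nth_default// size_sort.
have /(all_nthP 0)/(_ k) : all (>= 0) (sort >=%R s) by rewrite all_sort.
rewrite size_sort => /(_ ks) xge0; apply/eqP; rewrite eq_le xge0 andbT leNgt.
apply/negP => xgt0; suff : (k.+1 <= count (> 0%R) s)%N by rewrite leqNgt ltnS sk.
rewrite -(count_sort >=%R) -(cat_take_drop k.+1 (sort >=%R s)) count_cat.
have sz : size (take k.+1 (sort >=%R s)) = k.+1.
  by rewrite size_takel// size_sort.
apply: leq_trans (leq_addr _ _); rewrite -[leqLHS]sz.
suff : all (> 0) (take k.+1 (sort >=%R s)) by rewrite all_count => /eqP ->.
apply/(all_nthP 0) => i; rewrite sz => ik; rewrite nth_take//.
apply: (lt_le_trans xgt0).
have sorted_s : sorted >=%R (sort >=%R s) by apply: sort_sorted; exact: ge_total.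
by apply: (sorted_leq_nth ge_trans ge_refl 0 sorted_s) => //; rewrite ?inE ?size_sort//
  (leq_trans ik)//.
Qed.

End NonincreasingSort.

(** * Singular values and low-rank truncation *)

Section SingularValues.
Local Open Scope sesquilinear_scope.
Local Open Scope complex_scope.
Context {R : realType}.

(** Both kinds of matrix space embed isometrically into complex matrices with this norm, so one
    argument serves both. *)
Definition frob m n (A : 'M[R[i]]_(m, n)) : R :=
  Num.sqrt (complex.Re (\tr (A ^t* *m A))).

Lemma tr_adjoint_mul m n (A : 'M[R[i]]_(m, n)) :
  \tr (A ^t* *m A) = \sum_j \sum_i `|A i j| ^+ 2.
Proof.
apply: eq_bigr => j _; rewrite mxE; apply: eq_bigr => i _.
by rewrite !mxE normCKC.
Qed.

Lemma tr_adjoint_mul_ge0 m n (A : 'M[R[i]]_(m, n)) : 0 <= \tr (A ^t* *m A).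
Proof.
by rewrite tr_adjoint_mul; do 2![apply: sumr_ge0 => ? _]; exact: exprn_ge0.
Qed.

Lemma sqr_frob m n (A : 'M[R[i]]_(m, n)) : (frob A)%:C ^+ 2 = \tr (A ^t* *m A).
Proof.
rewrite -rmorphXn/=; have := tr_adjoint_mul_ge0 A; rewrite /frob; case: (\tr _) => x y.
by rewrite lecE/= => /andP[/eqP -> x0]; rewrite sqr_sqrtr.
Qed.

Lemma ler_entry_frob m n (A : 'M[R[i]]_(m, n)) i j : `|A i j| <= (frob A)%:C.
Proof.
rewrite -(@ler_pXn2r _ 2) ?nnegrE ?normr_ge0 ?lecR ?sqrtr_ge0//.
rewrite sqr_frob tr_adjoint_mul (bigD1 j)//= (bigD1 i)//= -addrA lerDl.
by rewrite addr_ge0// sumr_ge0// => k _; rewrite ?exprn_ge0// sumr_ge0// => l _;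
  rewrite exprn_ge0.
Qed.

Lemma ler_l1norm_frob m n (A : 'M[R[i]]_(m, n)) :
  mx_l1norm A <= ((m * n)%:R * frob A)%:C.
Proof.
apply: (@le_trans _ _ (\sum_(i < m) \sum_(j < n) (frob A)%:C)).
  by apply: ler_sum => i _; apply: ler_sum => j _; exact: ler_entry_frob.
by rewrite !sumr_const !card_ord -mulrnA mulnC mulr_natl rmorphMn.
Qed.

Lemma adjoint_mul_normal m n (A : 'M[R[i]]_(m, n)) : A ^t* *m A \is normalmx.
Proof.
apply/normalmxP; suff -> : (A ^t* *m A) ^t* = A ^t* *m A by [].
by rewrite trmx_mul map_mxM trmxCK.
Qed.

Lemma singular_values_ge0 m n (A : 'M[R[i]]_(m, n)) k :
  0 <= nth 0 (singular_values A) k.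
Proof.
have [ks|sk] := ltnP k (size (singular_values A)); last by rewrite nth_default.
apply: (allP _ _ (mem_nth _ ks)); rewrite all_sort all_map.
by apply/allP => j _; exact: sqrtr_ge0.
Qed.

(** Diagonalizing [A ^t* *m A] shows that its number of nonzero eigenvalues is its rank, hence at
    most [\rank A]. *)
Lemma singular_values_eq0 m n (A : 'M[R[i]]_(m, n)) k :
  (\rank A <= k)%N -> nth 0 (singular_values A) k = 0.
Proof.
move=> rAk; apply: sort_ge_eq0.
  by rewrite all_map; apply/allP => j _; exact: sqrtr_ge0.
apply: leq_trans rAk; apply: leq_trans (mxrankM_maxr (A ^t*) A).
rewrite [in leqRHS](orthomx_spectralP (adjoint_mul_normal A)).
set P := spectralmx _; set d := spectral_diag _.
have Pu : P \in unitmx by exact: spectral_unit.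
rewrite -mulmxA eqmxMfull ?row_full_unit ?unitmx_inv// mxrankMfree ?row_free_unit//.
rewrite mxrank_diag count_map cardE enumT size_filter -enumT.
apply: sub_count => j /=; apply: contraTN => /eqP ->.
by rewrite -leNgt sqrtr0.
Qed.

(* [N] is the truncation of the singular value decomposition of [A] to its k
   leading terms. *)
Lemma singular_value_truncation m n (A : 'M[R[i]]_(m, n)) k :
  exists2 N, (\rank N <= k)%N &
    frob (A - N) <= Num.sqrt n%:R * nth 0 (singular_values A) k.
Proof.
set s := nth 0 _ k; set G := A ^t* *m A.
pose P := spectralmx G; pose d := spectral_diag G.
have PP : P *m P ^t* = 1%:M by apply/unitarymxP; exact: spectral_unitarymx.
have PP' : P ^t* *m P = 1%:M by exact: mulmx1C.
have GE : G = P ^t* *m diag_mx d *m P.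
  rewrite -invmx_unitary ?spectral_unitarymx//.
  by apply/orthomx_spectralP; exact: adjoint_mul_normal.
pose f j : R := Num.sqrt (complex.Re (d 0 j)).
(* Complementary selectors: [e'] keeps the singular values above [s], at most [k] in number, and [e]
   the others. *)
pose e : 'rV[R[i]]_n := \row_j (f j <= s)%R%:R.
pose e' : 'rV[R[i]]_n := \row_j (s < f j)%R%:R.
have ee' : diag_mx e + diag_mx e' = 1%:M.
  rewrite -linearD/=; apply/matrixP => i j; rewrite !mxE leNgt.
  by case: (s < f i); rewrite /= ?addr0 ?add0r.
(* Multiplying [A] by a spectral projector of [A ^t* *m A] truncates it without introducing left
   singular vectors. *)
pose N := A *m P ^t* *m diag_mx e' *m P.
exists N.
  rewrite (leq_trans (mxrankM_maxl _ _))// (leq_trans (mxrankM_maxr _ _))//.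
  rewrite mxrank_diag; apply: leq_trans (sort_ge_count [seq f j | j <- enum 'I_n] k).
  rewrite count_map cardE enumT size_filter -enumT.
  apply: sub_count => j; rewrite -[_ j]/(e' 0 j != 0) -[preim _ _ j]/(s < f j) mxE.
  by case: ltP => //; rewrite eqxx.
have AN : A - N = A *m P ^t* *m diag_mx e *m P.
  apply/eqP; rewrite subr_eq -mulmxDl -mulmxDr ee' mulmx1.
  by rewrite -mulmxA PP' mulmx1.
have e_adj : (diag_mx e) ^t* = diag_mx e.
  rewrite tr_diag_mx map_diag_mx; congr diag_mx; apply/matrixP => i j.
  by rewrite !mxE rmorph_nat.
have sge0 : 0 <= s by exact: singular_values_ge0.
rewrite -(@ler_pXn2r _ 2) ?nnegrE ?mulr_ge0 ?sqrtr_ge0//.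
rewrite exprMn (@sqr_sqrtr _ n%:R) ?ler0n// -lecR [leLHS]rmorphXn/= sqr_frob AN.
have PGP : P *m G *m P ^t* = diag_mx d.
  by rewrite GE !mulmxA PP mul1mx -mulmxA PP mulmx1.
(* By cyclicity of the trace, the squared error is the sum of the discarded eigenvalues, each at
   most [s ^+ 2]. *)
have -> : \tr ((A *m P ^t* *m diag_mx e *m P) ^t* *m (A *m P ^t* *m diag_mx e *m P))
   = \tr (diag_mx e *m diag_mx d *m diag_mx e).
  rewrite mulmxA mxtrace_mulC !(trmx_mul, map_mxM) trmxCK e_adj !mulmxA PP mul1mx.
  by rewrite -PGP /G !mulmxA.
rewrite !mulmx_diag mxtrace_diag.
apply: (@le_trans _ _ (\sum_(j < n) (s ^+ 2)%:C)); last first.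
  by rewrite sumr_const card_ord mulr_natl rmorphMn.
apply: ler_sum => j _; rewrite !mxE.
have dj_ge0 : 0 <= d 0 j.
  (* The eigenvalue is the squared norm of column [j] of [A *m P ^t*]. *)
  have -> : d 0 j = \sum_i `|(A *m P ^t*) i j| ^+ 2.
    have -> : d 0 j = (P *m G *m P ^t*) j j by rewrite PGP mxE eqxx.
    rewrite /G !mulmxA -[_ *m A *m _]mulmxA mxE; apply: eq_bigr => i _.
    rewrite normCKC; congr (_ * _).
    by rewrite -[P in LHS]trmxCK -map_mxM -trmx_mul !mxE.
  by apply: sumr_ge0 => i _; exact: exprn_ge0.
have -> : d 0 j = (f j ^+ 2)%:C.
  rewrite /f; case: (d 0 j) dj_ge0 => x y; rewrite lecE/= => /andP[/eqP -> x0].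
  by rewrite sqr_sqrtr.
case: leP => fjs; last by rewrite !(mul0r, mulr0) lecR sqr_ge0.
by rewrite mul1r mulr1 lecR lerXn2r ?nnegrE ?sqrtr_ge0.
Qed.

End SingularValues.

(** * Local lower bounds on the tail sum *)

Section TailSum.
Local Open Scope sesquilinear_scope.
Local Open Scope complex_scope.
Context {R : realType}.

(** If the value at position [k] were small for some [B] near [A], the truncation of [B] would be a
    matrix of rank at most [k] too close to [A]. *)
Lemma singular_value_lower_bound m n (A : 'M[R[i]]_(m, n)) k :
  (k < \rank A)%N ->
  exists2 e : R, 0 < e &
    forall B, frob (A - B) < e -> e <= nth 0 (singular_values B) k.
Proof.
move=> kA; have [[r ?]] := mxrank_lower_semicontinuous A.
rewrite ltcE/= => /andP[/eqP -> r0] rankP.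
have sq0 : 0 <= Num.sqrt n%:R :> R by exact: sqrtr_ge0.
have mn0 : 0 <= (m * n)%:R :> R by exact: ler0n.
(* The product bounds the entrywise norm of [A - N] in units of [r / c]; the final 1 makes that
   bound strictly less than [r]. *)
pose c : R := (m * n)%:R * (1 + Num.sqrt n%:R) + 1.
have c0 : 0 < c by rewrite ltr_wpDl// mulr_ge0// addr_ge0.
exists (r / c) => [|B ABe]; first exact: divr_gt0.
rewrite leNgt; apply/negP => se.
have [N Nk BN] := singular_value_truncation B k.
suff /rankP : mx_l1norm (A - N) < r%:C by rewrite leqNgt (leq_ltn_trans Nk kA).
rewrite -[A](subrK B) -addrA; apply: le_lt_trans (mx_l1normD _ _) _.
apply: le_lt_trans (lerD (ler_l1norm_frob _) (ler_l1norm_frob _)) _.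
rewrite -rmorphD/= ltcR -mulrDr.
have -> : r = c * (r / c) by rewrite mulrCA divff ?mulr1// gt_eqF.
rewrite {1}/c mulrDl mul1r.
have : (m * n)%:R * (frob (A - B) + frob (B - N)) <=
    (m * n)%:R * (1 + Num.sqrt n%:R) * (r / c).
  rewrite -mulrA ler_wpM2l// mulrDl mul1r lerD ?(ltW ABe)//.
  by apply: le_trans BN _; rewrite ler_wpM2l// ltW.
by move=> /le_lt_trans; apply; rewrite ltrDl divr_gt0.
Qed.

Lemma frob_map_real_complex m n (A : 'M[R]_(m, n)) :
  frob (map_mx (real_complex R) A) = `|A : rect_mx R m n|.
Proof.
rewrite /frob.
have -> : (map_mx (real_complex R) A) ^t* = map_mx (real_complex R) A^T.
  by apply/matrixP => i j; rewrite !mxE; exact: conjc_real.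
by rewrite -map_mxM trace_map_mx.
Qed.

Lemma sigma_ge0 (k : space_kind) (X : matrix_space R k) i : 0 <= sigma i X.
Proof. by case: k X => [m n|n] X; exact: singular_values_ge0. Qed.

Lemma sigma_eq0 (k : space_kind) (X : matrix_space R k) i :
  (mx_rank X < i)%N -> sigma i X = 0.
Proof.
(* [sigma] counts from 1 and [nth] from 0, whence the shift. *)
case: i => // i; rewrite ltnS.
case: k X => [m n|n] X rX; apply: singular_values_eq0 => //.
by rewrite mxrank_map.
Qed.

Lemma sigma_lower_bound (k : space_kind) (X : matrix_space R k) i :
  (i < mx_rank X)%N ->
  exists2 e : R, 0 < e & forall Z, `|X - Z| < e -> e <= sigma i.+1 Z.
Proof.
case: k X => [m n|n] X iX.
  have := @singular_value_lower_bound _ _ (map_mx (real_complex R) (X : 'M[R]_(m, n))) i.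
  rewrite mxrank_map => /(_ iX)[e e0 eP]; exists e => // Z XZ; apply: eP.
  apply: le_lt_trans XZ.
  by rewrite -map_mxB frob_map_real_complex.
have [e e0 eP] := @singular_value_lower_bound _ _ (herm_val X) i iX.
exists e => // Z XZ; apply: eP.
by apply: le_lt_trans XZ; rewrite lexx.
Qed.

Variable (k : space_kind) (kappa : nat).
Implicit Types X Z : matrix_space R k.

Lemma tail_sum_ge0 X : 0 <= tail_sum kappa X.
Proof. by apply: sumr_ge0 => i _; exact: sigma_ge0. Qed.

Lemma tail_sum_eq0 X : rank_le kappa X -> tail_sum kappa X = 0.
Proof.
move=> rX; rewrite /tail_sum big_nat big1// => i /andP[ki _].
by apply: sigma_eq0; exact: leq_ltn_trans ki.
Qed.

Lemma tail_sum_lower_bound X : 0 < tail_sum kappa X ->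
  exists2 e : R, 0 < e & forall Z, `|X - Z| < e -> e <= tail_sum kappa Z.
Proof.
move=> tX; have kX : (kappa < mx_rank X)%N.
  by rewrite ltnNge; apply/negP => /tail_sum_eq0 t0; rewrite t0 ltxx in tX.
(* A positive sum is nonempty, so its first term is the singular value of index [kappa.+1], which
   bounds it below. *)
have kn : (kappa < min_dim k)%N.
  rewrite ltnNge; apply/negP => nk; move: tX.
  by rewrite /tail_sum big_geq ?ltxx.
have [e e0 eP] := sigma_lower_bound kX; exists e => // Z /eP/le_trans; apply.
rewrite /tail_sum big_ltn ?ltnS// lerDl.
by apply: sumr_ge0 => i _; exact: sigma_ge0.
Qed.

End TailSum.

(** * Distance to a set in a normed space *)

Section NormedDistance.
Context {R : realType} {V : normedModType R}.

Lemma edist_normE (x y : V) : edist (x, y) = `|x - y|%:E.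
Proof.
apply/eqP; rewrite eq_le; apply/andP; split.
  (* Balls are open, so the norm itself is not an admissible radius; any larger number is. *)
  apply/lee_addgt0Pr => e e0; rewrite -EFinD; apply: edist_fin.
    by rewrite ltr_wpDl.
  by rewrite /= -ball_normE /= ltrDl.
apply: le_ereal_inf_tmp => _ /= [r [r0 xyr] <-].
by rewrite lee_fin ltW//; move: xyr; rewrite -ball_normE.
Qed.

Lemma edist_inf_le_norm (A : set V) x a :
  A a -> (edist_inf A x <= `|x - a|%:E)%E.
Proof.
by move=> Aa; rewrite -edist_normE; apply: ereal_inf_lbound; exists a.
Qed.

Lemma edist_inf_lt (A : set V) x (r : \bar R) : (edist_inf A x < r)%E ->
  exists2 a, A a & (`|x - a|%:E < r)%E.
Proof. by case/ereal_inf_lt => _ [a Aa <-]; rewrite edist_normE; exists a. Qed.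

Lemma edist_inf_set1 (a x : V) : edist_inf [set a] x = `|x - a|%:E.
Proof. by rewrite /edist_inf image_set1 ereal_inf1 edist_normE. Qed.

End NormedDistance.

(** * Calmness and the global error bound *)

Section ErrorBound.
Context {R : realType} {k : space_kind}.
Variables (Omega : set (matrix_space R k)) (kappa : nat).

Lemma edist_inf_multi_inv Z : Omega Z ->
  edist_inf (multi_inv (Gamma Omega kappa) Z) 0 = (tail_sum kappa Z)%:E.
Proof.
move=> OZ; have -> : multi_inv (Gamma Omega kappa) Z = [set tail_sum kappa Z].
  by apply/seteqP; split => [y [_ <-]//|y ->].
by rewrite edist_inf_set1 sub0r normrN ger0_norm// tail_sum_ge0.
Qed.

Lemma error_bound_of_calm : compact Omega -> Gamma Omega kappa 0 !=set0 ->
  (forall X, Gamma Omega kappa 0 X -> calm (Gamma Omega kappa) 0 X) ->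
  exists2 c : R, 0 < c & forall Z, Omega Z ->
    (edist_inf (Gamma Omega kappa 0%R) Z <= (c * tail_sum kappa Z)%:E)%E.
Proof.
move=> cO [X0 GX0] calmG.
have [M [_ OM]] := compact_bounded cO.
pose D := `|M| + 1 + `|X0|.
have D0 : 0 <= D by rewrite !addr_ge0.
have distD Z : Omega Z -> (edist_inf (Gamma Omega kappa 0%R) Z <= D%:E)%E.
  move=> OZ; apply: le_trans (edist_inf_le_norm _ GX0) _.
  rewrite lee_fin (le_trans (ler_normB _ _))// lerD2r.
  by apply: OM => //; rewrite (le_lt_trans (ler_norm M))// ltrDl.
(* Where the tail sum is at least [e], the constant [D / e] already absorbs the bound [D] on the
   distance. *)
have far c e Z : 0 < e -> D / e <= c -> Omega Z -> e <= tail_sum kappa Z ->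
    (edist_inf (Gamma Omega kappa 0%R) Z <= (c * tail_sum kappa Z)%:E)%E.
  move=> e0 Dec OZ eZ; apply: le_trans (distD _ OZ) _; rewrite lee_fin.
  have -> : D = D / e * e by rewrite divfK ?gt_eqF.
  by rewrite ler_pM ?divr_ge0// ltW.
(* The bound is claimed for all large [c], so that the near-covering form of compactness makes the
   local constants uniform. *)
suff : \forall c \near +oo, Omega `<=` [set Z |
    (edist_inf (Gamma Omega kappa 0%R) Z <= (c * tail_sum kappa Z)%:E)%E].
  move=> [N [_ NP]]; exists (`|N| + 1); first by rewrite ltr_wpDl.
  by apply: NP; rewrite (le_lt_trans (ler_norm N))// ltrDl.
have /compact_near_coveringP/near_covering_withinP := cO.
apply => X OX; have [tX|tX] := leP (tail_sum kappa X) 0.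
  have GX : Gamma Omega kappa 0 X.
    by split => //; apply/eqP; rewrite eq_le tX tail_sum_ge0.
  have [a a0 [U [W [/nbhs_ballP[d /= d0 dU] XW UW]]]] := calmG X GX.
  (* Calmness, applied at the value [tail_sum kappa Z], gives [a] when that value is below [d];
     otherwise [D / d] suffices. *)
  exists (W, [set c | Num.max a (D / d) <= c]).
    by split => //=; apply: nbhs_pinfty_ge; exact: num_real.
  move=> [Z c] [/= WZ]; rewrite ge_max => /andP[ac dc] OZ.
  have [Zd|dZ] := ltP (tail_sum kappa Z) d; last exact: far dZ.
  have [|z Gz [b b1 zbE]] := UW (tail_sum kappa Z) _ Z (conj (conj OZ erefl) WZ).
    by apply: dU; rewrite -ball_normE/= sub0r normrN ger0_norm// tail_sum_ge0.
  apply: le_trans (edist_inf_le_norm _ Gz) _; rewrite lee_fin -[Z in leLHS]zbE addrC addKr.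
  rewrite normrZ subr0 normrM normr_id (ger0_norm a0) ger0_norm ?tail_sum_ge0//.
  rewrite -[leRHS]mulr1 ler_pM// ?mulr_ge0 ?tail_sum_ge0//.
  by rewrite ler_wpM2r ?tail_sum_ge0.
have [e e0 eP] := tail_sum_lower_bound tX.
exists (ball X e, [set c | D / e <= c]).
  by split => /=; [exact: nbhsx_ballx|apply: nbhs_pinfty_ge; exact: num_real].
move=> [Z c] [/= XZ Dec] OZ; apply: far Dec OZ _ => //.
by apply: eP; move: XZ; rewrite -ball_normE.
Qed.

Lemma calm_of_error_bound (c : R) : 0 < c ->
  (forall Z, Omega Z ->
    (edist_inf (Gamma Omega kappa 0%R) Z <= (c * tail_sum kappa Z)%:E)%E) ->
  forall X, calm (Gamma Omega kappa) 0 X.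
Proof.
move=> c0 cP X; exists (2 * c); first by rewrite mulr_ge0// ltW.
exists setT, setT; split; [exact: filterT|exact: filterT|].
move=> y _ Z [[OZ <-] _]; rewrite subr0 ger0_norm ?tail_sum_ge0//.
set t := tail_sum kappa Z.
have : 0 <= t by exact: tail_sum_ge0.
rewrite le_eqVlt => /predU1P[t0|t0].
  (* A zero tail sum puts [Z] itself in the target set; the rescaling used below would divide by
     zero. *)
  exists Z; first by split.
  by exists 0; rewrite /= ?normr0// scaler0 addr0.
have ct0 : 0 < 2 * c * t by rewrite !mulr_gt0.
have /edist_inf_lt[z Gz] :
    (edist_inf (Gamma Omega kappa 0%R) Z < (2 * c * t)%:E)%E.
  apply: le_lt_trans (cP Z OZ) _.
  by rewrite lte_fin -/t -mulrA ltr_pMl ?mulr_gt0// ltr1n.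
(* The strict gap between [c] and [2 * c] supplies a nearby point [z]; the rescaled difference then
   lies in the unit ball. *)
rewrite lte_fin => Zz; exists z => //; exists ((2 * c * t)^-1 *: (Z - z)).
  rewrite /= normrZ gtr0_norm ?invr_gt0// ler_pdivrMl// mulr1.
  exact: ltW.
by rewrite scalerA divff ?gt_eqF// scale1r addrC subrK.
Qed.

End ErrorBound.

Theorem theorem2p1 (R : realType) (k : space_kind) (Omega : set (matrix_space R k))
    (kappa : nat) (Omega_convex : convex_set Omega)
    (Omega_compact : compact Omega) (kappa_gt0 : (0 < kappa)%N)
    (Omega_rank : Omega `&` rank_le kappa !=set0) :
  (forall X : matrix_space R k, Gamma Omega kappa 0 X -> calm (Gamma Omega kappa) 0 X)
  <->
  (exists2 c : R, 0 < c &
    forall Z : matrix_space R k, Omega Z ->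
      (edist_inf (Gamma Omega kappa 0%R) Z
        <= c%:E * edist_inf (multi_inv (Gamma Omega kappa) Z) 0%R)%E /\
      (c%:E * edist_inf (multi_inv (Gamma Omega kappa) Z) 0%R)%E
        = (c * tail_sum kappa Z)%:E).
Proof.
split=> [calmG|[c c0 cP] X _].
  have G0 : Gamma Omega kappa 0 !=set0.
    by case: Omega_rank => X [OX rX]; exists X; split => //; exact: tail_sum_eq0.
  have [c c0 cP] := error_bound_of_calm Omega_compact G0 calmG.
  by exists c => // Z OZ; rewrite edist_inf_multi_inv// -EFinM; split => //; exact: cP.
apply: calm_of_error_bound c0 _ X => Z OZ.
by have [+ <-] := cP Z OZ.
Qed.
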